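(* Let $p$ be a prime and let $G$ be a finite group such that $\overline{G}=G/O_p(G)$ is isomorphic to a direct product of some $p$-TI-groups. Then $\chi_p(G)=1$ if and only if one of the following holds: (1) $G$ is $p$-closed; or (2) $p=2$ and $\overline{G}=A\times X_1\times\cdots\times X_m$, where $A$ is a $2'$-subgroup, $X_i\cong S_3$ for each $i$, and $m$ is a positive even integer.
   Context: $O_p(G)$ is the largest normal $p$-subgroup of $G$. A finite group $G$ with Sylow $p$-subgroup $P$ is a $p$-TI-group if for each $g\in G$, either $P\cap P^g=1$ or $P=P^g$. $G$ is $p$-closed if it has a normal Sylow $p$-subgroup. A $2'$-subgroup is a subgroup of odd order; $S_3$ is the symmetric group of degree 3. $\mathscr{C}_p(G)$ is the poset, ordered by inclusion, of all right cosets $Hx$ ($x\in G$) of $p$-subgroups $H$ of $G$ (including the trivial subgroup). For a finite poset $\mathcal{P}$, $\chi(\mathcal{P})=\sum_{i\ge 0}(-1)^i\#\{\text{chains of } i+1 \text{ elements in }\mathcal{P}\}$ is the (non-reduced) Euler characteristic of its order complex. $|G|_{p'}$ is the largest positive divisor of $|G|$ coprime to $p$, and $\chi_p(G):=\chi(\mathscr{C}_p(G))/|G|_{p'}$, which is an integer. *)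

(* Defs.v *)
From HB Require Import structures.
From mathcomp Require Import all_boot all_order all_algebra all_fingroup all_solvable.
Set Implicit Arguments.
Unset Strict Implicit.
Unset Printing Implicit Defensive.
Import GroupScope GRing.Theory.

Definition pTI_group (p : nat) (gT : finGroupType) (G : {group gT}) : Prop :=
  forall P : {group gT}, p.-Sylow(G) P ->
  forall g : gT, g \in G -> P :&: P :^ g = 1 \/ P :^ g = P.

Definition p_closed (p : nat) (gT : finGroupType) (G : {group gT}) : Prop :=
  exists2 P : {group gT}, p.-Sylow(G) P & P <| G.

Definition is_chain (T : finType) (r : rel T) (c : {set T}) : bool :=
  [forall x in c, forall y in c, r x y || r y x].

(* The poset is the subset X of T, ordered by r. A chain in X has at most     *)
(* #|X| elements, whence the upper bound of the sum.                          *)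
Definition euler_char (T : finType) (r : rel T) (X : {set T}) : int :=
  (\sum_(0 <= i < #|X|)
     (-1) ^+ i *
     #|[set c : {set T} | [&& c \subset X, is_chain r c & #|c| == i.+1]]|%:Z)%R.

Definition coset_poset (p : nat) (gT : finGroupType) (G : {group gT}) :
    {set {set gT}} :=
  [set C : {set gT} | [exists H : {group gT},
     [&& H \subset G, p.-group H & C \in rcosets H G]]].

(* The quotient is an integer, but is taken in rat so that no truncated       *)
(* division is involved.                                                      *)
Definition chi_p (p : nat) (gT : finGroupType) (G : {group gT}) : rat :=
  ((euler_char (fun C D : {set gT} => C \subset D) (coset_poset p G))%:~R
   / (#|G|`_p^')%:R)%R.

(* Main.v *)
Require Import Defs.
From mathcomp Require Import all_boot all_order all_algebra all_fingroup all_solvable.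
From mathcomp Require Import zify ring.
Import GroupScope.
Import GRing.Theory Num.Theory.
Set Implicit Arguments.
Unset Strict Implicit.
Unset Printing Implicit Defensive.

(** The Euler characteristic of a poset can be read off any integer weight on
    its elements for which the elements above each given point have total
    weight 1: it is the sum of all the weights ([euler_char_weighted]).  For
    cosets of p-subgroups such a weight comes from a list of p-subgroups [Q] of
    [G] with integer coefficients such that every p-subgroup lies in members of
    total coefficient 1; giving each coset of [Q] the coefficient of [Q] turns
    the Euler characteristic into the sum of the numbers [|G : Q|] times the
    coefficients ([chi_valueE]).

    Such lists are easy to transport.  They can be pulled back along a
    homomorphism whose kernel is a p-group ([chi_value_morphim]), so [chi_p]
    does not change when [G] is replaced by [G / 'O_p(G)]; and they multiply
    along direct products ([chi_value_dprod]), because a p-subgroup lies in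
    [Q1 \x Q2] exactly when its two projections lie in [Q1] and [Q2].  In a
    p-TI-group with [n] Sylow p-subgroups, of order [q], one takes each Sylow
    subgroup once and the trivial group [1 - n] times: a nontrivial p-subgroup
    lies in only one Sylow subgroup.  This gives the value
    [1 - (n - 1) (q - 1)] ([chi_value_TI]).

    So [chi_p p G] is a product of integers [1 - (n_i - 1) (q_i - 1)].  It is 1
    only if each factor is 1 or -1, with an even number of factors -1.  A factor
    1 means [n_i = 1], and then the Sylow subgroup is trivial, being contained
    in ['O_p(G / 'O_p(G)) = 1].  As [n_i] is congruent to 1 modulo [p], a factor -1
    forces [p = 2], [q_i = 2] and [n_i = 3] ([ti_value_unit]).  In that case the
    three involutions generate a copy of [S_3] on which conjugation is faithful,
    and the kernel of conjugation is a complement of odd order that centralises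
    it ([S3_factor]).  Collecting the kernels and the factors of odd order into
    [A] gives the decomposition in the second alternative.  Conversely, the
    value of such a decomposition is the product of a factor 1 for [A] and one
    factor -1 for each copy of [S_3]. *)

(** * Euler characteristics from weights *)

Section EulerCharacteristic.
Variables (T : finType) (r : rel T).
Hypotheses (r_refl : reflexive r) (r_trans : transitive r).
Implicit Types (X c : {set T}) (x y z : T).

Lemma is_chainP c :
  reflect {in c &, forall x y, r x y || r y x} (is_chain r c).
Proof.
apply: (iffP forall_inP) => [rc x y cx cy | rc x cx].
  by have /forall_inP := rc x cx; apply.
by apply/forall_inP => y cy; apply: rc.
Qed.

(** The greatest element is found as one with the largest down-set. *)
Lemma is_chain_max c :
  c != set0 -> is_chain r c -> exists2 z, z \in c & {in c, forall y, r y z}.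
Proof.
case/set0Pn=> x0 cx0 /is_chainP rc.
case: (arg_maxnP (fun z => #|[set y | r y z]|) cx0) => z cz zmax.
exists z => // y cy; have /orP[//|rzy] := rc y z cy cz.
have sub: [set t | r t z] \subset [set t | r t y].
  by apply/subsetP => t; rewrite !inE => /r_trans; apply.
have /eqP eq_zy : [set t | r t z] == [set t | r t y].
  by rewrite eqEcard sub; apply: zmax.
by have/setP/(_ y) := eq_zy; rewrite !inE r_refl.
Qed.

Lemma euler_charE X :
  euler_char r X =
  (\sum_(c : {set T} | [&& c != set0, c \subset X & is_chain r c])
      (-1) ^+ #|c|.-1)%R.
Proof.
rewrite /euler_char big_mkord.
have [->|X0] := eqVneq X set0.
  rewrite cards0 big_ord0 big1 // => c /and3P[c0].
  by rewrite subset0 (negPf c0).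
have oX: 0 < #|X| by rewrite card_gt0.
pose h (c : {set T}) : 'I_#|X| := insubd (Ordinal oX) #|c|.-1.
have hE c : c != set0 -> c \subset X -> h c = #|c|.-1 :> nat.
  move=> c0 sc; apply: insubdK.
  have: (#|c| <= #|X|)%N by rewrite subset_leq_card.
  by move: c0; rewrite -card_gt0; case: #|c|.
rewrite [RHS](partition_big h predT) //=; apply: eq_bigr => i _.
transitivity
  (\sum_(c in [set c : {set T} | [&& c \subset X, is_chain r c & #|c| == i.+1]])
     (-1) ^+ i : int)%R.
  by rewrite sumr_const -mulr_natr natz.
apply: eq_big => [c | c].
  rewrite inE; have [->|c0] := eqVneq c set0; first by rewrite cards0 !andbF.
  case sc: (c \subset X) => //=; case: is_chain => //=.
  by rewrite -val_eqE /= hE // -[RHS]eqSS prednK ?card_gt0.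
by rewrite inE => /and3P[_ _ /eqP->].
Qed.

(** The elements below [z] form a cone with apex [z]: adding or removing [z]
    pairs off all the chains with opposite signs, except the chain [z] alone,
    which corresponds to the empty chain. *)
Lemma sum_chains_below X z :
  z \in X ->
  (\sum_(c : {set T} | [&& c != set0, c \subset X & is_chain r c] &&
                       [forall y in c, r y z]) (-1) ^+ #|c|.-1 = 1 :> int)%R.
Proof.
move=> Xz; set Q := BIG_P.
have QU c : z \notin c -> Q (z |: c) = (c == set0) || Q c.
  move=> z'c; have [->|c0 /=] := eqVneq c set0.
    rewrite setU0; apply/andP; split; last by apply/forall_inP => y /set1P->.
    apply/and3P; split; rewrite ?sub1set //.
      by apply/set0Pn; exists z; rewrite inE.
    by apply/is_chainP => x y /set1P-> /set1P->; rewrite r_refl.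
  rewrite /Q c0 /= subUset sub1set Xz setU_eq0 (negPf c0) andbF /=.
  apply/andP/andP=> [] [/andP[sc /is_chainP cc] /forall_inP cz].
    split; last by apply/forall_inP => y cy; rewrite cz // inE cy orbT.
    by rewrite sc; apply/is_chainP=> x y cx cy; apply: cc;
      rewrite inE ?cx ?cy orbT.
  have cz' y : y \in z |: c -> r y z by move=> /setU1P[->|/cz//].
  split; last exact/forall_inP.
  rewrite sc; apply/is_chainP => x y /[dup] xz /setU1P[->|cx]; last first.
    by move/setU1P=> [->|]; [rewrite cz' | apply: cc].
  by move=> yz; rewrite (cz' y) ?orbT.
rewrite (bigID (fun c : {set T} => z \in c)) /=.
rewrite (reindex_onto (fun c => z |: c) (fun c => c :\ z)) /=; last first.
  by move=> c /andP[_ zc]; rewrite setD1K.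
rewrite (eq_bigl (fun c => ((c == set0) || Q c) && (z \notin c))); last first.
  move=> c; rewrite setU11 andbT; case: (boolP (z \in c)) => zc; last first.
    by rewrite setU1K // QU // eqxx !andbT.
  rewrite andbF; apply/negbTE; rewrite negb_and orbC; apply/orP; left.
  by apply/eqP=> /setP/(_ z); rewrite !inE eqxx zc.
(* Both sums now run over sets without z, the first one (from the chains with
   z) having the extra term set0, which contributes the 1. *)
rewrite (bigD1 set0) ?eqxx ?inE //= cardsU1 inE cards0 expr0 -addrA.
rewrite -[RHS]addr0; congr (_ + _)%R.
rewrite (eq_bigl (fun c => Q c && (z \notin c))); last first.
  by move=> c; rewrite andbAC /Q; case: eqVneq => //= _; rewrite andbT.
rewrite -big_split big1 //= => c /andP[/andP[/andP[c0 _] _] z'c].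
by rewrite cardsU1 z'c -[in X in (X + _)%R](@prednK #|c|) ?card_gt0 //=
  exprS mulN1r addNr.
Qed.

(** A nonempty chain has a greatest element, so the elements above all of it
    have total weight 1.  Inserting these weights in the sum over chains and
    exchanging the sums leaves, for each element [z], its weight times the sum
    over the chains below [z], which is 1. *)
Lemma euler_char_weighted (s : seq (T * int)) X :
  {in s, forall q, q.1 \in X} ->
  {in X, forall x, \sum_(q <- s | r x q.1) q.2 = 1}%R ->
  euler_char r X = (\sum_(q <- s) q.2)%R.
Proof.
move=> sX s1; rewrite euler_charE.
transitivity (\sum_(q <- s) \sum_(c : {set T} |
  [&& c != set0, c \subset X & is_chain r c] && [forall y in c, r y q.1])
     q.2 * (-1) ^+ #|c|.-1)%R; last first.
  rewrite big_seq [RHS]big_seq; apply: eq_bigr => q /sX Xq.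
  by rewrite -big_distrr /= sum_chains_below // mulr1.
rewrite (exchange_big_dep
  (fun c : {set T} => [&& c != set0, c \subset X & is_chain r c]))
  /=; last first.
  by move=> q c _ /andP[].
apply: eq_bigr => c /and3P[c0 sc cc]; rewrite c0 sc cc -big_distrl /=.
have [z zc zmax] := is_chain_max c0 cc.
rewrite (eq_bigl (fun q => r z q.1)) => [|q].
  by rewrite s1 ?mul1r // (subsetP sc).
apply/forall_inP/idP => [/(_ z zc)// | rzq y cy].
exact: r_trans (zmax y cy) rzq.
Qed.

End EulerCharacteristic.

(** * Coset posets of p-subgroups *)

(** An inclusion-exclusion formula: the p-subgroups of [G] form the union of the
    sets of subgroups of the Sylow subgroups, and [s] writes the indicator
    function of this union as an integer combination of such sets. *)
Definition p_resolution (p : nat) (gT : finGroupType) (G : {group gT})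
    (s : seq ({group gT} * int)) : Prop :=
  (forall q, q \in s -> q.1 \subset G /\ p.-group q.1) /\
  forall R : {group gT}, R \subset G -> p.-group R ->
    (\sum_(q <- s | R \subset q.1) q.2 = 1)%R.

(** The equation is kept multiplied by the p'-part of [#|G|], so that everything
    stays in the integers; [v] is the value of [chi_p] by [chi_valueE]. *)
Definition chi_value (p : nat) (gT : finGroupType) (G : {group gT}) (v : int) :
    Prop :=
  exists2 s, p_resolution p G s &
    (\sum_(q <- s) #|G : q.1|%:Z * q.2 = v * (#|G|`_p^')%:Z)%R.

(** Each coset of a member [Q] of the list inherits the coefficient of [Q].  A
    coset [R :* x] lies in some coset of [Q] only if [R \subset Q], and then
    only in [Q :* x], so the weights above [R :* x] add up to 1. *)
Lemma chi_valueE (p : nat) (gT : finGroupType) (G : {group gT}) v :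
  chi_value p G v -> chi_p p G = v%:~R%R.
Proof.
case=> s [sG s1] sv.
rewrite /chi_p; set r := fun C D : {set gT} => _.
pose w := [seq (D, q.2) | q : {group gT} * int <- s, D <- enum (rcosets q.1 G)].
rewrite (@euler_char_weighted _ r _ _ w).
- rewrite big_allpairs_dep /=.
  rewrite (eq_bigr (fun q : {group gT} * int => #|G : q.1|%:Z * q.2)%R).
    rewrite sv rmorphM /= -pmulrn mulfK // pnatr_eq0 -lt0n.
    exact: part_gt0.
  move=> q _; rewrite big_const_seq count_predT -cardE iter_addr_0.
  by rewrite -mulr_natl natz.
- by move=> C; apply: subxx.
- by move=> C D E; rewrite /r => DC CE; apply: subset_trans CE.
- move=> D /allpairsPdep[q [C [sq]]]; rewrite mem_enum => GC -> /=.
  rewrite inE; apply/existsP; exists q.1; have [-> ->] := sG q sq.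
  by rewrite GC.
move=> _ /[!inE] /existsP[R /and3P[sRG pR /rcosetsP[x Gx ->]]].
rewrite -[RHS](s1 R) // [LHS]big_mkcond big_allpairs_dep [RHS]big_mkcond /=.
rewrite big_seq [RHS]big_seq; apply: eq_bigr => q /sG[sqG _].
have mem_sub D : D \in rcosets q.1 G ->
    (R :* x \subset D) = (R \subset q.1) && (D == q.1 :* x).
  case/rcosetsP=> y Gy ->; apply/idP/andP => [sRx | [sR /eqP->]]; last first.
    by rewrite mulSg.
  have /rcoset_eqP eqxy: x \in q.1 :* y.
    by apply: (subsetP sRx); rewrite rcoset_refl.
  by rewrite -eqxy rcosetS in sRx *; rewrite eqxx.
rewrite big_enum -big_mkcondr /=.
case: (boolP (R \subset q.1)) => sR; last first.
  by rewrite big1 // => D /andP[GD]; rewrite /r mem_sub // (negPf sR).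
rewrite (big_pred1 (q.1 :* x)) // => D /=; apply/andP/eqP => [[GD]|->].
  by rewrite /r mem_sub // => /andP[_ /eqP].
have GD : q.1 :* x \in rcosets q.1 G by apply/rcosetsP; exists x.
by rewrite GD /r mem_sub // sR eqxx.
Qed.

(** * Homomorphisms and direct products *)

(** Preimages of p-subgroups are p-subgroups since the kernel is a p-group;
    inclusion in a preimage is inclusion of the image, and indices are kept. *)
Lemma chi_value_morphim (p : nat) (gT rT : finGroupType) (D G : {group gT})
    (f : {morphism D >-> rT}) v :
  G \subset D -> 'ker f \subset G -> p.-group ('ker f) ->
  chi_value p (f @* G) v -> chi_value p G v.
Proof.
move=> sGD sKG pK [s [sG s1] sv].
have sfD (A : {set rT}) : A \subset f @* G -> A \subset f @* D.
  by move=> sA; apply: subset_trans sA (morphimS _ sGD).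
exists [seq ((f @*^-1 q.1)%G, q.2) | q : {group rT} * int <- s]; last first.
  rewrite big_map /=.
  have -> : (#|G|`_p^' = #|f @* G|`_p^')%N.
    have := card_morphpre (sfD _ (subxx _)); rewrite morphimGK // => ->.
    by rewrite partnM ?cardG_gt0 // part_p'nat ?pnatNK // mul1n.
  rewrite -sv; apply: eq_big_seq => q /sG[sqG _].
  by rewrite -[in LHS](morphimGK sKG sGD) index_morphpre // sfD.
split=> [_ /mapP[q /sG[sqG pq] ->] /= | R sRG pR].
  rewrite -(morphimGK sKG sGD) morphpreS //; split=> //.
  by rewrite /pgroup card_morphpre ?sfD // pnatM; apply/andP.
rewrite big_map -(s1 (f @* R)%G) ?morphimS ?morphim_pgroup //.
by apply: eq_bigl => q; rewrite sub_morphim_pre // (subset_trans sRG).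
Qed.

Lemma chi_value_isog (p : nat) (gT rT : finGroupType) (G : {group gT})
    (K : {group rT}) v :
  G \isog K -> chi_value p K v -> chi_value p G v.
Proof.
case/isogP=> f injf fG vK; have kf1: 'ker f = 1 by apply/trivgP.
apply: (@chi_value_morphim _ _ _ G G f); rewrite ?subxx ?kf1 ?sub1G ?pgroup1 //.
by rewrite (_ : (f @* G)%G = K) //; apply: val_inj.
Qed.

Lemma chi_value_quotient (p : nat) (gT : finGroupType) (G N : {group gT}) v :
  N <| G -> p.-group N -> chi_value p (G / N) v -> chi_value p G v.
Proof.
case/andP=> sNG nNG pN; apply: chi_value_morphim; by rewrite ?ker_coset.
Qed.

(** The sum over pairs factors because [R] lies in [Q1 <*> Q2] exactly when its
    projections on the factors do.  The projection of [R] on [A] is encoded as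
    [A :&: R <*> B]. *)
Lemma chi_value_dprod (p : nat) (gT : finGroupType) (A B G : {group gT}) v w :
  A \x B = G -> chi_value p A v -> chi_value p B w -> chi_value p G (v * w)%R.
Proof.
move=> defG [s [sA s1] sv] [t [tB t1] tw].
have [_ defAB cAB tiAB] := dprodP defG.
have [nAG nBG] := dprod_normal2 defG.
pose m (q q' : {group gT} * int) := ((q.1 <*> q'.1)%G, q.2 * q'.2)%R.
have defq q q' : q \in s -> q' \in t -> q.1 \x q'.1 = q.1 <*> q'.1.
  move=> /sA[sqA _] /tB[sqB _].
  by rewrite dprodEY ?(centSS sqB sqA) //; apply/trivgP; rewrite -tiAB setISS.
have sGq q q' : q \in s -> q' \in t -> q.1 <*> q'.1 \subset G.
  move=> /sA[sqA _] /tB[sqB _]; rewrite join_subG.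
  by rewrite (subset_trans sqA) ?(subset_trans sqB) ?normal_sub.
exists [seq m q q' | q <- s, q' <- t]; last first.
  rewrite big_allpairs_dep -(dprod_card defG) partnM ?cardG_gt0 // PoszM.
  rewrite mulrACA -sv -tw mulr_suml; apply: eq_big_seq => q sq.
  rewrite mulr_sumr; apply: eq_big_seq => q' tq' /=.
  rewrite mulrACA -PoszM; congr (_%:Z * _)%R.
  have [sqA _] := sA _ sq; have [sqB _] := tB _ tq'.
  apply/eqP; rewrite -(eqn_pmul2l (cardG_gt0 (q.1 <*> q'.1))) Lagrange ?sGq //.
  by rewrite -(dprod_card (defq _ _ sq tq')) mulnACA !Lagrange //
    (dprod_card defG).
split=> [_ /allpairsP[[q q'] /= [sq tq' ->]] /= | R sRG pR].
  have [_ pq] := sA _ sq; have [_ pq'] := tB _ tq'.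
  rewrite sGq //; split => //.
  by rewrite /pgroup -(dprod_card (defq _ _ sq tq')) pnatM; apply/andP.
(* The projection meets the kernel F trivially, so it embeds in R <*> F / F,
   a quotient of R. *)
have pproj (E F : {group gT}) : F <| G -> E :&: F = 1 -> E \subset G ->
    p.-group (E :&: R <*> F).
  move=> /andP[sFG nFG] tiEF sEG; have nFE := subset_trans sEG nFG.
  have nFX: E :&: R <*> F \subset 'N(F) by rewrite subIset // nFE.
  have tiX: F :&: (E :&: R <*> F) = 1.
    by rewrite setIA [F :&: E]setIC tiEF; apply/setIidPl; rewrite sub1G.
  rewrite (isog_pgroup _ (quotient_isog nFX tiX)).
  apply: pgroupS (quotient_pgroup F pR).
  have nFR := subset_trans sRG nFG.
  by rewrite /= -quotientYidr // quotientS // subsetIr.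
have tiBA: B :&: A = 1 by rewrite setIC.
have sAG := normal_sub nAG; have sBG := normal_sub nBG.
pose RA := (A :&: R <*> B)%G; pose RB := (B :&: R <*> A)%G.
have RAE : R <*> B = R * B.
  by rewrite norm_joinEl // (subset_trans sRG) ?normal_norm.
have RBE : R <*> A = R * A.
  by rewrite norm_joinEl // (subset_trans sRG) ?normal_norm.
have sub_q q q' : q \in s -> q' \in t ->
    (R \subset q.1 <*> q'.1) = (RA \subset q.1) && (RB \subset q'.1).
  move=> sq tq'; have [sqA _] := sA _ sq; have [sqB _] := tB _ tq'.
  have defqq' := defq _ _ sq tq'; have [_ {}defqq' _ _] := dprodP defqq'.
  rewrite -defqq' /= RAE RBE; apply/idP/andP => [sR | [sRA sRB]].
    split; apply/subsetP => g /setIP[].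
      move=> Ag /mulsgP[r b /(subsetP sR) /mulsgP[x y qx qy ->] Bb Dg].
      have Ax := subsetP sqA x qx.
      have: x^-1 * g \in A :&: B.
        rewrite inE groupM ?groupV //= Dg -mulgA mulKg groupM //.
        exact: (subsetP sqB).
      by rewrite tiAB => /set1P/(canRL (mulKVg x)) ->; rewrite mulg1.
    move=> Bg /mulsgP[r a /(subsetP sR) /mulsgP[x y qx qy ->] Aa Dg].
    have By := subsetP sqB y qy; have Ax := subsetP sqA x qx.
    have: g * y^-1 \in B :&: A.
      have cya := centsP cAB y By a Aa.
      by rewrite inE groupM ?groupV //= Dg -(mulgA x) cya mulgA mulgK groupM.
    by rewrite tiBA => /set1P/(canRL (mulgKV y)) ->; rewrite mul1g.
  apply/subsetP => r Rr; have := subsetP sRG r Rr; rewrite -defAB.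
  case/mulsgP=> a b Aa Bb Dr; rewrite Dr; apply: mem_mulg.
    apply: (subsetP sRA); rewrite inE Aa /=; apply/mulsgP.
    by exists r b^-1; rewrite ?groupV // Dr mulgK.
  apply: (subsetP sRB); rewrite inE Bb /=; apply/mulsgP.
  exists r a^-1; rewrite ?groupV // Dr.
  have cab := esym (centsP cAB b Bb a Aa).
  by rewrite cab mulgK.
rewrite big_mkcond big_allpairs_dep /=.
rewrite -[RHS]mulr1 -{1}(s1 RA) ?subsetIl ?pproj //.
rewrite -(t1 RB) ?subsetIl ?pproj // [in RHS]big_mkcond mulr_suml.
apply: eq_big_seq => q sq; rewrite [in RHS]big_mkcond mulr_sumr.
apply: eq_big_seq => q' tq' /=; rewrite sub_q //.
by case: (RA \subset _); case: (RB \subset _); rewrite ?mul0r ?mulr0.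
Qed.

Lemma chi_value1 (p : nat) (gT : finGroupType) : chi_value p (1%G : {group gT}) 1.
Proof.
exists [:: (1%G, 1%R)].
  split=> [q | R sR1 _]; last by rewrite big_cons big_nil sR1 addr0.
  by rewrite inE => /eqP-> /=; rewrite subxx pgroup1.
by rewrite big_seq1 indexgg cards1 partn1.
Qed.

Lemma chi_value_bigdprod (p : nat) (gT : finGroupType) I (r : seq I) (P : pred I)
    (H : I -> {group gT}) (v : I -> int) (G : {group gT}) :
  \big[dprod/1]_(i <- r | P i) H i = G ->
  (forall i, P i -> chi_value p (H i) (v i)) ->
  chi_value p G (\prod_(i <- r | P i) v i)%R.
Proof.
move=> + Hv; elim: r G => [|i r IHr] G.
  by rewrite !big_nil => G1; rewrite -(group_inj G1); apply: chi_value1.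
rewrite !big_cons; case: ifP => [Pi|_]; last exact: IHr.
move=> defG; have [[_ K _ defK] _ _ _] := dprodP defG.
by apply: chi_value_dprod (Hv i Pi) (IHr K defK); rewrite -defK.
Qed.

(** * TI-groups *)

(** The value [n - (n - 1) q] for [n] Sylow subgroups of order [q], in the form
    that shows which values are units. *)
Definition ti_value (p : nat) (gT : finGroupType) (G : {group gT}) : int :=
  (1 - (#|'Syl_p(G)|%:Z - 1) * ((#|G|`_p)%:Z - 1))%R.

Lemma pTI_unique_Sylow (p : nat) (gT : finGroupType) (G P Q R : {group gT}) :
  pTI_group p G -> p.-Sylow(G) P -> p.-Sylow(G) Q ->
  R \subset P -> R \subset Q -> R :!=: 1 -> P = Q.
Proof.
move=> tiG sylP /(Sylow_trans sylP)[x Gx defQ] sRP sRQ /eqP ntR.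
case: (tiG P sylP x Gx) => [ti|]; last by rewrite -defQ => /group_inj.
by case: ntR; apply/trivgP; rewrite -ti subsetI sRP -defQ.
Qed.

(** Every Sylow subgroup is taken once; the trivial subgroup lies in all of them
    and its coefficient [1 - n] corrects this excess. *)
Lemma chi_value_TI (p : nat) (gT : finGroupType) (G : {group gT}) :
  pTI_group p G -> chi_value p G (ti_value p G).
Proof.
move=> tiG; set n := #|'Syl_p(G)|.
exists ((1%G, (1 - n%:Z)%R) :: [seq (P, 1%R) | P <- enum 'Syl_p(G)]).
  split=> [q | R sRG pR].
    rewrite inE => /predU1P[->|/mapP[P]] /=; first by rewrite sub1G pgroup1.
    by rewrite mem_enum inE => sylP ->;
      rewrite (pHall_sub sylP) (pHall_pgroup sylP).
  rewrite big_cons big_map big_enum_cond /= subG1.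
  have [R1|ntR] := eqVneq (R : {set gT}) 1.
    rewrite (eq_bigl (mem 'Syl_p(G))) => [|P]; last by rewrite R1 sub1G andbT.
    by rewrite sumr_const natz subrK.
  have [P sylP sRP] := Sylow_superset sRG pR.
  rewrite (eq_bigl (pred1 P)) ?big_pred1_eq // => Q /=; rewrite inE.
  apply/andP/eqP=> [[sylQ sRQ]|->//].
  exact: pTI_unique_Sylow tiG sylQ sylP sRQ sRP ntR.
rewrite big_cons big_map big_enum /= indexg1.
rewrite (eq_bigr (fun=> (#|G|`_p^')%:Z)%R) => [|P]; last first.
  rewrite inE => sylP; rewrite mulr1 -divgS ?(pHall_sub sylP) //.
  rewrite (card_Hall sylP) -{1}(partnC p (cardG_gt0 G)) mulKn ?part_gt0 //.
rewrite sumr_const -/n -mulr_natl natz.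
rewrite -{1}(partnC p (cardG_gt0 G)) PoszM /ti_value -/n.
ring.
Qed.

Lemma ti_value_normal (p : nat) (gT : finGroupType) (G : {group gT}) :
  #|'Syl_p(G)| = 1%N -> ti_value p G = 1%R.
Proof. by rewrite /ti_value => ->; rewrite subrr mul0r subr0. Qed.

Lemma p'group_card_Syl (p : nat) (gT : finGroupType) (G : {group gT}) :
  p^'.-group G -> #|'Syl_p(G)| = 1%N.
Proof.
move=> p'G; apply/eqP/normal_sylowP; exists 1%G; last exact: normal1.
by rewrite pHallE sub1G cards1 part_p'nat.
Qed.

(** A value -1 means that [(n - 1) (q - 1) = 2].  As [p] divides both [n - 1]
    and [q], neither can be less than [p], which leaves only [n = 3] and
    [q = 2]. *)
Lemma ti_value_unit (p : nat) (gT : finGroupType) (G : {group gT}) :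
  prime p -> ti_value p G \is a GRing.unit ->
  #|'Syl_p(G)| = 1%N \/ [/\ p = 2, #|'Syl_p(G)| = 3 & (#|G|`_p)%N = 2].
Proof.
move=> p_pr; rewrite /ti_value; have p_gt1 := prime_gt1 p_pr.
case Ep: (p \in \pi(G)); last first.
  left; apply: p'group_card_Syl; rewrite /pgroup p'natEpi //; exact: negbT Ep.
have dvdP: p %| (#|G|`_p)%N.
  by rewrite p_part -{1}(expn1 p) dvdn_exp2l // logn_gt0.
have P_gt1 : 1 < (#|G|`_p)%N by rewrite p_part_gt1.
have := card_Syl_mod G p_pr.
move: #|_| (#|G|`_p)%N dvdP P_gt1 => n P dvdP P_gt1 n1.
have n_gt0: 0 < n by case: n n1 => //; rewrite mod0n.
have {n1} dvdn: p %| n.-1.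
  by rewrite -subn1 -eqn_mod_dvd // n1 modn_small.
rewrite unfold_in => v1.
case: (posnP n.-1) => [n0|n'_gt0]; first by left; lia.
have {v1} : (n.-1 * P.-1 = 2)%N.
  by move: v1 => /orP[]/eqP; nia.
have := dvdn_leq n'_gt0 dvdn; have := dvdn_leq (ltnW P_gt1) dvdP => pP pn n2.
by right; split; nia.
Qed.

(** * Groups with three Sylow 2-subgroups of order 2 *)

(** Conjugation on an enumerated invariant family, as a morphism into ['S_n]
    itself rather than into the permutations of a subset of [gT]. *)
Lemma conj_morphism n (gT : finGroupType) (G : {group gT}) (t : 'I_n -> gT) :
  injective t -> (forall g i, g \in G -> exists j, t j = t i ^ g) ->
  exists f : {morphism G >-> 'S_n}, forall g i, g \in G -> t (f g i) = t i ^ g.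
Proof.
move=> injt tG.
pose f g : 'S_n := odflt 1 [pick s : 'S_n | [forall i, t (s i) == t i ^ g]].
have fE g i : g \in G -> t (f g i) = t i ^ g.
  move=> Gg; rewrite /f; case: pickP => [s /forallP/(_ i)/eqP // | no_s].
  have [u uE] := fin_all_exists (tG g ^~ Gg).
  have inju: injective u.
    by move=> j k /(congr1 t); rewrite !uE => /conjg_inj/injt.
  have /forallP[] := no_s (perm inju); move=> j.
  by rewrite permE uE.
have fM : {in G &, {morph f : x y / x * y}}.
  move=> x y Gx Gy; apply/permP => i; apply: injt.
  by rewrite permM !fE ?groupM // conjgM.
by exists (Morphism fM).
Qed.

Section ThreeInvolutions.
Variables (gT : finGroupType) (G : {group gT}).
Hypotheses (nSyl : #|'Syl_2(G)| = 3%N) (oP : (#|G|`_2 = 2)%N).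

Lemma involution_Sylow x : x \in G -> #[x] = 2 -> 2.-Sylow(G) <[x]>.
Proof. by move=> Gx ox; rewrite pHallE cycle_subG Gx oP -ox eqxx. Qed.

Lemma Sylow_involution (P : {group gT}) :
  2.-Sylow(G) P -> exists2 x, x \in G /\ #[x] = 2 & P = <[x]>%G.
Proof.
move=> sylP; have oP2 : #|P| = 2 by rewrite (card_Hall sylP).
have /cyclicP[x defP] : cyclic P by rewrite prime_cyclic ?oP2.
exists x; last exact: group_inj.
rewrite orderE -defP oP2; split=> //; apply: (subsetP (pHall_sub sylP)).
by rewrite defP cycle_id.
Qed.

(** Two distinct commuting involutions would generate a group of order 4. *)
Lemma commuting_involutions x y :
  x \in G -> #[x] = 2 -> y \in G -> #[y] = 2 -> commute x y -> x = y.
Proof.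
move=> Gx ox Gy oy cxy; have sylx := involution_Sylow Gx ox.
have sub: <[x]> \subset 'N_G(<[x]>) by rewrite subsetI cycle_subG Gx normG.
have sylN := pHall_subl sub (subsetIl _ _) sylx.
have nN: <[x]> <| 'N_G(<[x]>) by rewrite normalSG ?cycle_subG.
have: y \in <[x]>.
  rewrite (mem_normal_Hall sylN nN) ?in_setI ?Gy /p_elt ?oy //.
  by rewrite (subsetP (cent_sub _)) // cent_cycle; apply/cent1P.
rewrite cycle2g // => /set2P[y1|//].
by rewrite y1 order1 in oy.
Qed.

(** Each Sylow subgroup contains one involution.  If [x] and [y] are two of the
    three, both [x ^ y] and [y ^ x] differ from [x] and from [y], so they are
    the third one. *)
Lemma three_involutions : exists x y,
  [/\ x \in G /\ #[x] = 2, y \in G /\ #[y] = 2, uniq [:: x; y; x ^ y],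
      y ^ x = x ^ y &
      forall z, z \in G -> #[z] = 2 -> z \in [:: x; y; x ^ y]].
Proof.
have conj_out x y : x \in G -> #[x] = 2 -> y \in G -> #[y] = 2 -> x != y ->
    (x != x ^ y) && (y != x ^ y).
  move=> Gx ox Gy oy nexy; apply/andP; split; apply: contraNneq nexy => Dxy.
    rewrite (commuting_involutions Gx ox Gy oy) //.
    by apply/commgP/eqP; rewrite commgEl -Dxy mulVg.
  by apply/eqP/(conjg_inj y); rewrite -Dxy conjgE mulKg.
have [P] : exists P, P \in 'Syl_2(G) by apply/card_gt0P; rewrite nSyl.
rewrite inE => sylP; have [x [Gx ox] defP] := Sylow_involution sylP.
have [Q] : exists Q, Q \in 'Syl_2(G) :\ P.
  apply/card_gt0P; move: nSyl; rewrite (cardsD1 P) inE sylP /= add1n => [][->] //.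
rewrite !inE => /andP[nePQ sylQ]; have [y [Gy oy] defQ] := Sylow_involution sylQ.
have nexy : x != y by apply: contraNneq nePQ; rewrite defP defQ => ->.
have sylE z : z \in G -> #[z] = 2 -> <[z]>%G \in 'Syl_2(G).
  by move=> Gz oz; rewrite inE involution_Sylow.
have cycle_inj2 u v : #[u] = 2 -> #[v] = 2 -> <[u]>%G = <[v]>%G -> u = v.
  move=> ou ov /(congr1 val) /= /setP/(_ u).
  rewrite cycle_id !cycle2g // => /esym/set2P[u1|//].
  by rewrite u1 order1 in ou.
have /andP[nexc neyc] := conj_out x y Gx ox Gy oy nexy.
have oc : #[x ^ y] = 2 by rewrite orderJ.
have Gc : x ^ y \in G by rewrite groupJ.
have inv3 z : z \in G -> #[z] = 2 -> z \in [:: x; y; x ^ y].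
  move=> Gz oz; pose S := [set <[x]>%G; <[y]>%G; <[x ^ y]>%G].
  have /eqP defS : S == 'Syl_2(G).
    rewrite eqEcard nSyl !subUset !sub1set !sylE //=.
    rewrite /S setUC cardsU1 cards2 !inE negb_or.
    have ne u v : #[u] = 2 -> #[v] = 2 -> (<[u]>%G == <[v]>%G) = (u == v).
      by move=> ou ov; apply/eqP/eqP => [/cycle_inj2|->] //; apply.
    by rewrite !ne // nexy eq_sym nexc eq_sym neyc.
  have := sylE z Gz oz; rewrite -defS !inE.
  by rewrite -!orbA => /or3P[] /eqP/cycle_inj2 -> //; rewrite ?eqxx ?orbT.
exists x, y; split=> //.
  by rewrite /= !inE negb_or nexy nexc neyc.
have neyx : y != x by rewrite eq_sym.
have /andP[neyd nexd] := conj_out y x Gy oy Gx ox neyx.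
have := inv3 (y ^ x); rewrite groupJ // orderJ => /(_ isT oy).
by rewrite !inE eq_sym (negPf nexd) eq_sym (negPf neyd) => /eqP.
Qed.

End ThreeInvolutions.

(** The group [S] generated by the involutions is dihedral of order at most 6,
    since [x ^ y = y ^ x] amounts to [(x * y) ^+ 3 = 1].  Conjugation on the
    three involutions maps it onto a group of order divisible by 6, hence
    isomorphically onto ['S_3].  The kernel [C] of this action fixes the
    generators of [S], so it centralises [S] and is a complement to it; it has
    odd order because [S] already uses up the 2-part of [#|G|]. *)
Lemma S3_factor (gT : finGroupType) (G : {group gT}) :
  #|'Syl_2(G)| = 3 -> (#|G|`_2)%N = 2 ->
  exists C S : {group gT}, [/\ C \x S = G, odd #|C| & S \isog [set: 'S_3]].
Proof.
move=> nSyl oP; have [x [y [[Gx ox] [Gy oy] uxyz Dz inv3]]] :=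
  three_involutions nSyl oP.
pose t := tnth [tuple x; y; x ^ y].
have injt : injective t by apply/tuple_uniqP.
have t_inv i : t i \in G /\ #[t i] = 2.
  have: t i \in [tuple x; y; x ^ y] by apply: mem_tnth.
  by rewrite !inE => /or3P[]/eqP->; rewrite ?groupJ ?orderJ.
have tJ g i : g \in G -> exists j, t j = t i ^ g.
  move=> Gg; have [Gti oti] := t_inv i.
  have /(tnthP [tuple x; y; x ^ y])[j ->] : t i ^ g \in [tuple x; y; x ^ y].
    by apply: inv3; rewrite ?groupJ ?orderJ.
  by exists j.
have [f fE] := conj_morphism injt tJ.
have [nexz neyz] : x != x ^ y /\ y != x ^ y.
  by move: uxyz; rewrite /= !inE negb_or andbT => /andP[/andP[_ ->] ->].
have ker_cent g u : g \in 'ker f -> u \in G -> #[u] = 2 -> u ^ g = u.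
  move=> kg Gu ou; have Gg := dom_ker kg.
  have /(tnthP [tuple x; y; x ^ y])[i ->] := inv3 u Gu ou.
  by rewrite -[LHS](fE g i Gg) (mker kg) perm1.
pose S := (<<[set x; y]>>)%G.
have sSG : S \subset G by rewrite gen_subG subUset !sub1set Gx.
have [Sx Sy] : x \in S /\ y \in S.
  by split; apply: mem_gen; rewrite !inE eqxx ?orbT.
have xx : x * x = 1 by rewrite -[x * x]/(x ^+ 2) -ox expg_order.
have yy : y * y = 1 by rewrite -[y * y]/(y ^+ 2) -oy expg_order.
have xV : x^-1 = x by apply/eqP; rewrite eq_invg_mul xx.
have yV : y^-1 = y by apply/eqP; rewrite eq_invg_mul yy.
have braid : x * (y * x) = y * (x * y).
  by have := Dz; rewrite !conjgE xV yV.
have r3 : (x * y) ^+ 3 = 1.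
  have -> : (x * y) ^+ 3 = x * (y * x) * (y * (x * y)).
    by rewrite !expgS expg0 mulg1 !mulgA.
  by rewrite -braid -!mulgA (mulgA x x) xx mul1g (mulgA y y) yy mul1g.
have oS : #|S| <= 6.
  have sub : S \subset <[x * y]> * <[x]>.
    rewrite -norm_joinEr; last first.
      rewrite cycle_subG inE -cycleJ cycle_subG.
      have -> : (x * y) ^ x = (x * y)^-1.
        by rewrite conjgE -mulgA mulKg invMg xV yV.
      by rewrite groupV cycle_id.
    have [Nxy Nx] : x * y \in <[x * y]> <*> <[x]> /\ x \in <[x * y]> <*> <[x]>.
      split; [apply: (subsetP (joing_subl _ _)) | apply: (subsetP (joing_subr _ _))];
        exact: cycle_id.
    rewrite gen_subG subUset !sub1set Nx.
    by rewrite -{1}(mulKg x y) groupM ?groupV.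
  apply: leq_trans (subset_leq_card sub) _.
  apply: (@leq_trans (#[x * y] * #[x])).
    rewrite -[X in _ <= X]/(#|<[x * y]>| * #|<[x]>|)%N mul_cardG.
    by rewrite leq_pmulr ?cardG_gt0.
  by rewrite ox (@leq_mul _ _ 3 2) // dvdn_leq // order_dvdn r3.
have odvd g n : g \in S -> g ^+ n = 1 -> prime n -> g \notin 'ker f ->
    n %| #|f @* S|.
  move=> Sg gn n_pr nKg; have Gg := subsetP sSG g Sg.
  have <- : #[f g] = n; last by rewrite order_dvdG // mem_morphim.
  apply: nt_prime_order => //; first by rewrite -morphX // gn morph1.
  by apply: contra nKg => /eqP fg1; apply/kerP.
have ofS : 6 %| #|f @* S|.
  have nkx : x \notin 'ker f.
    apply/negP => /ker_cent/(_ Gy oy) yx.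
    by rewrite -Dz yx eqxx in neyz.
  have nkxy : x * y \notin 'ker f.
    apply/negP => /ker_cent/(_ Gx ox).
    by rewrite conjgM [x ^ x]conjgE mulKg => xy; rewrite xy eqxx in nexz.
  by rewrite (@Gauss_dvd 2 3) // (odvd x) // (odvd (x * y)) // groupM.
have ofS6 : #|f @* S| = 6.
  by apply/eqP; rewrite eqn_leq (leq_trans (leq_morphim _ _)) // dvdn_leq.
have oS6 : #|S| = 6.
  by apply/eqP; rewrite eqn_leq oS -ofS6 leq_morphim.
have fST : f @* S = [set: 'S_3].
  by apply/eqP; rewrite eqEcard subsetT ofS6 cardsT card_Sn.
have injf : 'injm (restrm sSG f) by rewrite -card_im_injm im_restrm ofS6 oS6.
have isoS : S \isog [set: 'S_3].
  by rewrite -fST -(im_restrm sSG); apply: sub_isog.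
have tiCS : 'ker f :&: S = 1.
  by have := injf; rewrite ker_restrm setIC => /trivgP.
have cSC : S \subset 'C('ker f).
  rewrite gen_subG subUset !sub1set.
  by apply/andP; split; apply/centP => g kg; apply/commgP/conjg_fixP;
    apply: ker_cent.
have oG : (#|'ker f| * 6)%N = #|G|.
  have fGT : f @* G = [set: 'S_3].
    by apply/eqP; rewrite eqEsubset subsetT -fST morphimS.
  have := card_morphim f G; rewrite fGT cardsT card_Sn setIid => oGK.
  by rewrite -[6]/(3`!) oGK Lagrange // subsetIl.
exists ('ker f)%G, S; split=> //.
  apply/eqP; rewrite dprodE // eqEcard mul_subG ?subsetIl //=.
  by rewrite TI_cardMg // oS6 oG.
move: oP; rewrite -oG partnM ?cardG_gt0 // => /eqP.
rewrite (_ : 6`_2 = 2)%N ?(p_part 2 6) // -[X in _ == X]mul1n eqn_pmul2r //.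
by rewrite partn_eq1 ?cardG_gt0 // odd_2'nat.
Qed.

Lemma pTI_prime_Sylow (p : nat) (gT : finGroupType) (G : {group gT}) :
  prime p -> (#|G|`_p)%N = p -> pTI_group p G.
Proof.
move=> p_pr oP P sylP g Gg; have oPp : #|P| = p by rewrite (card_Hall sylP).
have [ti|] := eqVneq (P :&: P :^ g) 1; [by left | move=> ntI; right].
have prP : prime #|P| by rewrite oPp.
have sP : P \subset P :^ g by apply: contraR ntI => /(prime_TIg prP)/eqP.
by apply/esym/eqP; rewrite eqEcard sP cardJg leqnn.
Qed.

(** The number of Sylow subgroups is odd and divides 6; it is not 1, since a
    normal Sylow subgroup of order 2 would contain all the transpositions. *)
Lemma card_Syl2_S3 : #|'Syl_2([set: 'S_3])| = 3.
Proof.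
have oS3 : #|[set: 'S_3]| = 6 by rewrite cardsT card_Sn.
have := card_Syl_dvd 2 [set: 'S_3]%G.
have := card_Syl_mod [set: 'S_3]%G (isT : prime 2).
rewrite /= oS3 => + dvdn; have := dvdn_leq (isT : 0 < 6) dvdn.
have: #|'Syl_2([set: 'S_3])| != 1%N.
  apply/negP => /normal_sylowP[P sylP nP].
  have inj_t (i j : 'I_3) : tperm ord0 i = tperm ord0 j -> i = j.
    by move/permP/(_ ord0); rewrite !tpermL.
  have ot (i : 'I_3) : i != ord0 -> #[tperm ord0 i] = 2.
    move=> ni0; apply: nt_prime_order => //; first exact: tperm2.
    by apply: contraNneq ni0; rewrite -(tperm1 ord0) => /inj_t/eqP.
  have tP (i : 'I_3) : i != ord0 -> tperm ord0 i \in P.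
    by move=> ni0; rewrite (mem_normal_Hall sylP nP) ?inE // /p_elt ot.
  pose i1 : 'I_3 := inord 1; pose i2 : 'I_3 := inord 2.
  have [n1 n2 n21] : [/\ i1 != ord0, i2 != ord0 & i2 != i1].
    by rewrite -!val_eqE /= !inordK.
  have defP : <[tperm ord0 i1]> = P.
    apply/eqP; rewrite eqEcard cycle_subG tP // (card_Hall sylP) oS3 (p_part 2 6).
    by rewrite -orderE ot.
  have := tP i2 n2; rewrite -defP cycle2g ?ot // => /set2P[|/inj_t/eqP].
    by rewrite -(tperm1 ord0) => /inj_t/eqP; apply/negP.
  exact/negP.
by move: #|_| dvdn; do 7?case => //.
Qed.

Lemma chi_value_S3 : chi_value 2 [set: 'S_3]%G (-1)%R.
Proof.
have oS3 : (#|[set: 'S_3]|`_2)%N = 2 by rewrite cardsT card_Sn (p_part 2 6).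
have := chi_value_TI (pTI_prime_Sylow (G := [set: 'S_3]%G) (isT : prime 2) oS3).
by rewrite /ti_value card_Syl2_S3 oS3.
Qed.

(** * Products of value 1 *)

(** Both kinds of factors are written uniformly as [C_i \x S_i], with [C_i] of
    odd order and [S_i] trivial or isomorphic to ['S_3], so that the product
    can be regrouped without reordering the index set. *)
Lemma TI_product_cases (p : nat) (gT : finGroupType) n (K : {group gT})
    (H : 'I_n -> {group gT}) :
  prime p -> 'O_p(K) = 1 -> \big[dprod/1]_(i < n) H i = K ->
  (\prod_(i < n) ti_value p (H i) = 1)%R ->
  p^'.-group K \/
  (p = 2 /\
   exists (m : nat) (A : {group gT}) (X : 'I_m -> {group gT}),
     [/\ 0 < m /\ ~~ odd m,
         odd #|A|,
         forall i : 'I_m, X i \isog [set: 'S_3]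
       & A \x \big[dprod/1]_(i < m) X i = K]).
Proof.
move=> p_pr Op1 defK v1.
have nHK i : H i <| K.
  move: defK; rewrite (bigD1 i) //= => defK.
  have [[_ L _ defL] _ _ _] := dprodP defK.
  by have [] := dprod_normal2 defK.
have vU i : ti_value p (H i) \is a GRing.unit.
  apply/unitrPr; move: v1; rewrite (bigD1 i) //= => v1.
  by eexists; exact: v1.
pose J : pred 'I_n := [pred i | #|'Syl_p(H i)| != 1%N].
have p'H i : i \notin J -> p^'.-group (H i).
  rewrite inE negbK => /normal_sylowP[P sylP nPH].
  (* P is characteristic in the normal subgroup H i of K. *)
  have : P \subset 'O_p(K).
    rewrite pcore_max ?(pHall_pgroup sylP) //.
    by rewrite -(normal_Hall_pcore sylP nPH) gFnormal_trans.
  rewrite Op1 => /trivgP P1; have := card_Hall sylP; rewrite P1 cards1.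
  by move=> /esym/eqP; rewrite partn_eq1.
have HJ i : i \in J -> [/\ p = 2, #|'Syl_p(H i)| = 3 & (#|H i|`_p)%N = 2].
  by case: (ti_value_unit p_pr (vU i)) => // H1; rewrite inE H1.
case: (pickP J) => [i0 Ji0 | noJ]; last first.
  left; rewrite /pgroup -(bigdprod_card defK).
  elim/big_ind: _ => // [a b pa pb|i _]; first by rewrite pnatM pa.
  by apply: p'H; apply/negbT; apply: noJ.
right; have [p2 _ _] := HJ i0 Ji0; split=> //; subst p.
have /fin_all_exists[CS defCS] i : exists CS : {group gT} * {group gT},
    [/\ CS.1 \x CS.2 = H i, odd #|CS.1| &
        if i \in J then (CS.2 \isog [set: 'S_3]) else CS.2 :==: 1].
  case Ji: (i \in J).
    have [_ nSyl oP] := HJ i Ji; have [C [S [dCS oC iS]]] := S3_factor nSyl oP.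
    by exists (C, S).
  exists (H i, 1%G); rewrite dprodg1 odd_2'nat; split=> //.
  by apply: p'H; rewrite Ji.
pose m := #|J|; pose X (j : 'I_m) := (CS (enum_val j)).2.
have evenm : ~~ odd m.
  move: v1; rewrite (bigID J) /= [X in (_ * X)%R]big1 => [|i]; last first.
    by rewrite negbK => /eqP; apply: ti_value_normal.
  rewrite (eq_bigr (fun=> (-1)%R)) => [|i Ji]; last first.
    by have [_ nSyl oP] := HJ i Ji; rewrite /ti_value nSyl oP.
  by rewrite prodr_const mulr1 -signr_odd -/m; case: odd.
have defCSK :
    (\big[dprod/1]_(i < n) (CS i).1) \x (\big[dprod/1]_(i < n) (CS i).2) = K.
  rewrite -big_split -defK; apply: eq_bigr => i _; by have [] := defCS i.
have [[A B defA defB] _ _ _] := dprodP defCSK.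
have defX : \big[dprod/1]_(j < m) X j = \big[dprod/1]_(i < n) (CS i).2.
  rewrite -(big_enum_val (fun i => (CS i).2 : {set gT})).
  rewrite big_mkcond; apply: eq_bigr => i _; case: ifP => // Ji.
  by have [_ _] := defCS i; rewrite Ji => /eqP.
exists m, A, X; split.
- by split=> //; apply/card_gt0P; exists i0.
- rewrite -(bigdprod_card defA); elim/big_ind: _ => // [a b|i _]; last first.
    by have [] := defCS i.
  by rewrite oddM => -> ->.
- by move=> j; have [_ _] := defCS (enum_val j); rewrite enum_valP.
by rewrite defX -defA.
Qed.

(** A group with a normal Sylow subgroup is a TI-group whose value is 1. *)
Lemma chi_value_closed (p : nat) (gT : finGroupType) (G : {group gT}) :
  p_closed p G -> chi_value p G 1.
Proof.
case=> P sylP nPG; rewrite -(@ti_value_normal p gT G); last first.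
  by apply/eqP/normal_sylowP; exists P.
apply: chi_value_TI => Q /(Sylow_trans sylP)[x Gx defQ] g Gg; right.
have PJ h : h \in G -> P :^ h = P.
  by move=> Gh; apply: normsP (normal_norm nPG) h Gh.
by rewrite defQ !PJ.
Qed.

Lemma p'group_closed (p : nat) (gT : finGroupType) (G : {group gT}) :
  p^'.-group G -> p_closed p G.
Proof. by move=> p'G; apply/normal_sylowP; rewrite p'group_card_Syl. Qed.

Theorem theorem3 (p : nat) (gT : finGroupType) (G : {group gT})
    (rT : finGroupType) (n : nat) (K : {group rT}) (H : 'I_n -> {group rT}) :
  prime p ->
  G / 'O_p(G) \isog K ->
  \big[dprod/1]_(i < n) H i = K ->
  (forall i : 'I_n, pTI_group p (H i)) ->
  chi_p p G = 1%R <->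
  p_closed p G \/
  (p = 2 /\
   exists (m : nat) (A : {group coset_of 'O_p(G)})
          (X : 'I_m -> {group coset_of 'O_p(G)}),
     [/\ 0 < m /\ ~~ odd m,
         odd #|A|,
         forall i : 'I_m, X i \isog [set: 'S_3]
       & A \x \big[dprod/1]_(i < m) X i = G / 'O_p(G)]).
Proof.
move=> p_pr isoGK defK tiH.
have chiG v : chi_value p (G / 'O_p(G))%G v -> chi_p p G = v%:~R%R.
  move=> chiGO; apply: chi_valueE.
  exact: chi_value_quotient (pcore_normal p G) (pcore_pgroup p G) chiGO.
have chiK := chi_value_bigdprod defK (fun i _ => chi_value_TI (tiH i)).
split=> [chi1 | [closedG | [p2 [m [A [X [[_ evenm] oddA isoX defGO]]]]]]].
- have v1 : (\prod_(i < n) ti_value p (H i) = 1)%R.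
    by apply/(@intr_inj rat); rewrite -(chiG _ (chi_value_isog isoGK chiK)) chi1.
  have Op1 : 'O_p(K) = 1.
    apply/eqP; rewrite trivg_card1 -(card_isog (isog_pcore p isoGK)) /=.
    by rewrite trivg_pcore_quotient cards1.
  case: (TI_product_cases p_pr Op1 defK v1)
    => [p'K | [p2 [m [A [X [m_gt0 oddA isoX defAX]]]]]].
    left; exists ('O_p(G))%G; last exact: pcore_normal.
    rewrite /pHall pcore_sub pcore_pgroup -card_quotient ?gFnorm //.
    by rewrite (card_isog isoGK).
  right; split=> //; have /isogP[f injf fK] := isog_symr isoGK.
  have [[_ B _ defB] _ _ _] := dprodP defAX; rewrite defB in defAX.
  have [/andP[sAK _] /andP[sBK _]] := dprod_normal2 defAX.
  have sXK i : X i \subset K.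
    by apply: subset_trans sBK; rewrite -(bigdprodWY defB) sub_gen //
      (bigcup_sup i).
  exists m, (f @* A)%G, (fun i => (f @* X i)%G); split=> //=.
  - by rewrite card_injm.
  - by move=> i; apply: isog_trans (isoX i); rewrite isog_sym sub_isog.
  by rewrite (injm_bigdprod _ _ defB) // (injm_dprod _ _ defAX).
- by rewrite (chi_valueE (chi_value_closed closedG)).
subst p.
have [[_ B _ defB] _ _ _] := dprodP defGO.
have chiA : chi_value 2 A 1.
  by apply/chi_value_closed/p'group_closed; rewrite /pgroup -odd_2'nat.
have chiB := chi_value_bigdprod defB
  (fun i _ => chi_value_isog (isoX i) chi_value_S3).
rewrite defB in defGO; rewrite (chiG _ (chi_value_dprod defGO chiA chiB)).
by rewrite mul1r prodr_const cardT size_enum_ord -signr_odd (negPf evenm).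
Qed.
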